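(* Let $G_1$ and $G_2$ be finite forests with the same vertex set $V(G_1)=V(G_2)=V$. Then there exists a simultaneous $2$-locally-balanced $2$-partition of $G_1$ and $G_2$; that is, there exists a function $f:V\to\{0,1\}$ such that for every $i\in\{1,2\}$ and every $v\in V$, $$b_f(\gamma_{G_i}(v))=\Big|\,|\{w\in\gamma_{G_i}(v): f(w)=1\}|-|\{w\in\gamma_{G_i}(v): f(w)=0\}|\,\Big|\le 2 .$$
   Context: Graphs are finite, undirected and without loops or multiple edges; a forest is an acyclic graph (not necessarily connected). The edge sets of $G_1$ and $G_2$ are otherwise unrelated. For a graph $G$ with vertex set $V(G)$ and edge set $E(G)$ and a vertex $v\in V(G)$, $\gamma_G(v)=\{w\in V(G): (w,v)\in E(G)\}$ is the set of neighbours of $v$ in $G$ (not including $v$ itself). A $2$-partition of a finite set $M$ is a function $f:M\to\{0,1\}$. For a $2$-partition $f$ of $M$ and a subset $M_0\subseteq M$, $b_f(M_0)=\big|\,|\{m\in M_0: f(m)=1\}|-|\{m\in M_0: f(m)=0\}|\,\big|$. For graphs $G_1,G_2$ with common vertex set $V$ and an integer $k\ge 0$, a $2$-partition $f$ of $V$ is called a simultaneous $k$-locally-balanced $2$-partition of $G_1$ and $G_2$ if $b_f(\gamma_{G_i}(v))\le k$ for all $i\in\{1,2\}$ and all $v\in V$. *)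

(* Defs.v *)
From mathcomp Require Import all_boot all_algebra.

Set Implicit Arguments.
Unset Strict Implicit.
Unset Printing Implicit Defensive.

(* A graph on the vertex set V is given by its adjacency relation. *)
Definition simple_graph (V : finType) (e : rel V) : Prop :=
  symmetric e /\ irreflexive e.

(* In [ucycle e c] the vertices of c are distinct and cyclically adjacent.
   This also holds for the empty sequence and for [:: x; y] with x, y the ends
   of an edge, so the graph-theoretic cycles are those of size at least 3. *)
Definition acyclic (V : finType) (e : rel V) : Prop :=
  forall c : seq V, ucycle e c -> ~~ (3 <= size c).

Definition forest (V : finType) (e : rel V) : Prop :=
  simple_graph e /\ acyclic e.

Definition neighbours (V : finType) (e : rel V) (v : V) : {set V} :=
  [set w | e w v].

(* A 2-partition f : M -> {0, 1} is encoded with true for 1 and false for 0.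
   The subtraction is in int; the outer absolute value is a nat. *)
Definition imbalance (M : finType) (f : M -> bool) (M0 : {set M}) : nat :=
  absz (#|[set m in M0 | f m == true]|%:Z
        - #|[set m in M0 | f m == false]|%:Z)%R.

Definition locally_balanced (V : finType) (k : nat) (e : rel V)
    (f : V -> bool) : Prop :=
  forall v : V, imbalance f (neighbours e v) <= k.

Definition simultaneous_locally_balanced (V : finType) (k : nat)
    (e1 e2 : rel V) (f : V -> bool) : Prop :=
  locally_balanced k e1 f /\ locally_balanced k e2 f.

(* Main.v *)
Require Import Defs.
From mathcomp Require Import all_boot all_algebra.
From mathcomp Require Import zify.

(** Root each component of a forest.  The neighbourhood of [v] is then its set
    of children together with at most one further vertex, its parent, and the
    sets of children are pairwise disjoint.  Pair up the vertices inside each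
    set of children, leaving at most one of them alone.  The two forests give
    two matchings of [V]; their union has only even cycles, so it is bipartite.
    A proper 2-colouring has imbalance at most 1 on each set of children, hence
    at most 2 on each neighbourhood. *)

Set Implicit Arguments.
Unset Strict Implicit.
Unset Printing Implicit Defensive.

(** The segment from [x] to [y] closes up through the edge [e y x]; this cycle has at least 3
    vertices unless [y] comes right after [x]. *)
Lemma acyclic_chordless (V : finType) (e : rel V) (x y : V) (p : seq V) :
  acyclic e -> path e x p -> uniq (x :: p) -> y \in p -> e y x ->
  y = head x p.
Proof.
move=> acyc pth unq yp eyx; case/splitPr: yp pth unq => -[//|z p1] p2.
rewrite -cat_rcons cat_path -cat_cons cat_uniq => /andP[pth _] /andP[unq _].
have /acyc : ucycle e (x :: rcons (z :: p1) y).
  by rewrite /ucycle unq andbT /cycle rcons_path pth last_rcons.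
by rewrite /= size_rcons.
Qed.

(** Otherwise every path starting in [S] extends at its front: by [acyclic_chordless], of two
    distinct neighbours of its first vertex at most one lies on it. Paths would then be arbitrarily
    long. *)
Lemma forest_leaf (V : finType) (e : rel V) (S : {set V}) (x0 : V) :
  forest e -> x0 \in S ->
  exists2 x, x \in S & {in S &, forall y z, e x y -> e x z -> y = z}.
Proof.
move=> [[sym irr] acyc] x0S.
have [/exists_inP[x xS /forall_inP leaf_x]|] := boolP [exists x in S,
    [forall y in S, [forall z in S, e x y ==> (e x z ==> (y == z))]]].
  exists x => // y z yS zS exy exz.
  have /forall_inP/(_ z zS) := leaf_x y yS.
  by rewrite exy exz => /eqP.
rewrite negb_exists_in => /forall_inP no_leaf.
have long n : exists x p,
    [/\ x \in S, path e x p, uniq (x :: p) & size p = n].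
  elim: n => [|n [x [p [xS pth unq sz]]]]; first by exists x0, [::].
  have extend y : y \in S -> e x y -> y \notin p -> exists x p,
      [/\ x \in S, path e x p, uniq (x :: p) & size p = n.+1].
    move=> yS exy yp; exists y, (x :: p); split=> //; last by rewrite /= sz.
      by rewrite /= sym exy.
    rewrite cons_uniq unq andbT inE negb_or yp andbT.
    by apply: contraTneq exy => ->; rewrite irr.
  have := no_leaf x xS.
  rewrite negb_forall_in => /exists_inP[y yS].
  rewrite negb_forall_in => /exists_inP[z zS].
  rewrite !negb_imply => /and3P[exy exz /eqP yz].
  have [yp|] := boolP (y \in p); last exact: extend.
  have [zp|] := boolP (z \in p); last exact: extend.
  case: yz; rewrite (acyclic_chordless acyc pth unq yp) 1?sym //.
  by rewrite (acyclic_chordless acyc pth unq zp) 1?sym.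
have [x [p [_ _ unq sz]]] := long #|V|.
by have := max_card (mem (x :: p)); rewrite (card_uniqP unq) /= sz ltnn.
Qed.

Lemma forest_parent (V : finType) (e : rel V) : forest e ->
  exists2 p : V -> option V, (forall x y, p x = Some y -> e x y) &
    forall x y, e x y -> p x = Some y \/ p y = Some x.
Proof.
move=> fe; have [[sym irr] _] := fe.
suff [p pe ep] : exists2 p : V -> option V, (forall x y, p x = Some y -> e x y)
    & {in [set: V] &, forall x y, e x y -> p x = Some y \/ p y = Some x}.
  by exists p => // x y; apply: ep.
(* Strip a leaf [x] of [S]: its only neighbour in [S], if any, becomes its parent, and the other
   edges inside [S] avoid [x]. *)
move: [set: V] => S; have [n] := ubnP #|S|; elim: n S => // n IHn S leSn.
have [->|[x0 x0S]] := set_0Vmem S.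
  by exists (fun=> None) => // x y; rewrite inE.
have [x xS leaf_x] := forest_leaf fe x0S.
have [|p pe ep] := IHn (S :\ x); first by move: leSn; rewrite (cardsD1 x) xS.
have pick_x y : y \in S -> e x y -> [pick z in S | e x z] = Some y.
  move=> yS exy; case: pickP => [z /andP[zS exz]|/(_ y)]; last first.
    by rewrite yS exy.
  by rewrite (leaf_x y z).
exists (fun y => if y == x then [pick z in S | e x z] else p y) => y z.
  case: eqP => [->|_]; last exact: pe.
  by case: pickP => // w /andP[_ exw] [<-].
move=> yS zS; case: (eqVneq y x) => [->|yx] eyz; first by left; apply: pick_x.
case: (eqVneq z x) => [zx|zx].
  by right; apply: pick_x; rewrite // sym -zx.
by apply: ep => //; rewrite !inE ?yx ?zx.
Qed.

(** Enumerate each class and swap positions $2i$ and $2i+1$. *)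
Lemma class_pairing (V : finType) (T : eqType) (c : V -> T) :
  exists s : V -> V, [/\ involutive s, forall x, c (s x) = c x &
    forall x y, s x = x -> s y = y -> c x = c y -> x = y].
Proof.
pose cls (t : T) := enum [pred x | c x == t].
have mem_cls t x : (x \in cls t) = (c x == t) by rewrite mem_enum.
have uniq_cls t : uniq (cls t) by apply: enum_uniq.
pose flip i := if odd i then i.-1 else i.+1.
have flipK : involutive flip.
  by move=> i; rewrite /flip; case: (boolP (odd i)) => oi; case: ifP; lia.
(* the default value of [nth] leaves the last vertex of an odd class fixed *)
pose s x := nth x (cls (c x)) (flip (index x (cls (c x)))).
have index_lt x : index x (cls (c x)) < size (cls (c x)).
  by rewrite index_mem mem_cls.
have cs x : c (s x) = c x.
  rewrite /s; set i := flip _; have [lt_i|le_i] := ltnP i (size (cls (c x))).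
    by apply/eqP; rewrite -mem_cls mem_nth.
  by rewrite nth_default.
exists s; split=> // [x|x y].
  rewrite {1}/s cs /s; set l := cls (c x); set i := flip (index x l).
  have [lt_i|le_i] := ltnP i (size l); last by rewrite !(nth_default _ le_i).
  by rewrite index_uniq ?uniq_cls // /i flipK nth_index ?mem_cls.
(* A fixed vertex stands last in its class, so a class has at most one. *)
have fixed z : s z = z -> (index z (cls (c z))).+1 = size (cls (c z)).
  rewrite /s; set l := cls (c z); set i := flip (index z l) => siz.
  have lt_z : index z l < size l := index_lt z.
  have [lt_i|le_i] := ltnP i (size l).
    have : index z l = i by rewrite -{1}siz index_uniq ?uniq_cls.
    by rewrite /i /flip; case: ifP; lia.
  by move: le_i; rewrite /i /flip; case: ifP; lia.
move=> /fixed sx /fixed sy cxy; rewrite cxy in sx.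
have eq_index : index x (cls (c y)) = index y (cls (c y)) by lia.
rewrite -[x](@nth_index _ x x (cls (c y))) ?mem_cls ?cxy //.
by rewrite eq_index nth_index ?mem_cls.
Qed.

(* The orbits of [t \o s] are the classes of vertices at even distance in the
   union of the two perfect matchings; [s] and [t] send an orbit to a different
   one, and both to the same one. *)
Lemma two_perfect_matchings_colouring (T : finType) (s t : T -> T) :
  involutive s -> involutive t ->
  (forall x, s x != x) -> (forall x, t x != x) ->
  exists f : T -> bool,
    (forall x, f (s x) = ~~ f x) /\ (forall x, f (t x) = ~~ f x).
Proof.
move=> sK tK sN tN; pose g := t \o s.
have g_inj : injective g by apply: inj_comp; apply: can_inj.
have gsg x : g (s (g x)) = s x by rewrite /g /= sK tK.
have gsgn n x : iter n g (s (iter n g x)) = s x.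
  by elim: n x => //= n IHn x; rewrite -iterS iterSr gsg IHn.
have disj x : ~~ fconnect g x (s x).
  (* If $s x = g^k x$, go to the middle [y] of this stretch of the orbit. As [s] reverses [g],
     cancelling $g^{\lfloor k/2\rfloor}$ gives $s y = y$ or $s y = t(s y)$, by the parity of [k]. *)
  apply/negP=> /iter_findex; set k := findex _ _ _ => gk.
  pose y := iter k./2 g x.
  have : iter k./2 g (s y) = iter k./2 g (iter (odd k) g y).
    by rewrite gsgn -gk /y -!iterD; congr (iter _ _ _); lia.
  elim: (k./2) => [|n IHn] /= => [|/g_inj//].
  case: (odd k) => /eqP; last by rewrite (negPf (sN _)).
  by rewrite eq_sym (negPf (tN _)).
have symg := fconnect_sym g_inj.
have rootg x : froot g (g x) = froot g x.
  by apply/eqP; rewrite root_connect // symg fconnect1.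
(* Ranks order the orbits; of two orbits exchanged by [s], the one of smaller rank gets colour
   [true]. *)
pose r x := enum_rank (froot g x).
exists (fun x => r x < r (s x)).
have rN x : r x != r (s x) :> nat.
  apply: contra (disj x) => /eqP/val_inj/enum_rank_inj/eqP.
  by rewrite root_connect.
have fs x : (r (s x) < r (s (s x))) = ~~ (r x < r (s x)).
  by rewrite sK -leqNgt ltn_neqAle eq_sym rN.
have rt x : r (t x) = r (s x) by rewrite -{1}[x]sK /r -[t _]/(g _) rootg.
have rst x : r (s (t x)) = r x by rewrite /r -rootg /g /= sK tK.
by split=> // x /=; rewrite -fs sK rt rst.
Qed.

Lemma two_matchings_colouring (V : finType) (s t : V -> V) :
  involutive s -> involutive t ->
  exists f : V -> bool, (forall x, s x != x -> f (s x) = ~~ f x) /\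
    (forall x, t x != x -> f (t x) = ~~ f x).
Proof.
move=> sK tK.
(* two copies of [V], each fixed vertex being matched with its own copy *)
pose dbl (u : V -> V) (z : V * bool) :=
  if u z.1 == z.1 then (z.1, ~~ z.2) else (u z.1, z.2).
have dblK u : involutive u -> involutive (dbl u).
  move=> uK [x b]; rewrite /dbl /=.
  have [ux|ux] /= := eqVneq (u x) x; first by rewrite ux eqxx negbK.
  by rewrite uK eq_sym (negPf ux).
have dblN u z : dbl u z != z.
  case: z => x b; rewrite /dbl /=.
  have [_|ux] := eqVneq (u x) x; rewrite xpair_eqE ?(negPf ux) //.
  by rewrite eqxx; case: b.
have [f [fs ft]] := two_perfect_matchings_colouring (dblK s sK) (dblK t tK)
  (dblN s) (dblN t).
exists (fun x => f (x, true)); split=> x ux.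
  by rewrite -fs /dbl /= (negPf ux).
by rewrite -ft /dbl /= (negPf ux).
Qed.

Lemma imbalance_le (V : finType) (f : V -> bool) (A : {set V}) (k : nat) :
  (imbalance f A <= k) =
  (#|[set x in A | f x]| <= #|[set x in A | ~~ f x]| + k) &&
  (#|[set x in A | ~~ f x]| <= #|[set x in A | f x]| + k).
Proof.
rewrite /imbalance.
have -> : [set m in A | f m == true] = [set x in A | f x].
  by apply/setP=> x; rewrite !inE eqb_id.
have -> : [set m in A | f m == false] = [set x in A | ~~ f x].
  by apply/setP=> x; rewrite !inE eqbF_neg.
by lia.
Qed.

Lemma imbalance_sub (V : finType) (f : V -> bool) (A B : {set V}) :
  A \subset B -> imbalance f B <= imbalance f A + #|B :\: A|.
Proof.
(* Each colour count grows by at most [#|B :\: A|] from [A] to [B], and never shrinks. *)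
move=> sAB; have := leqnn (imbalance f A).
rewrite !imbalance_le => /andP[le_pm le_mp].
have part (P : pred V) : #|[set x in A | P x]| <= #|[set x in B | P x]|
    <= #|[set x in A | P x]| + #|B :\: A|.
  rewrite subset_leq_card /=; last first.
    by apply/subsetP=> x; rewrite !inE => /andP[/(subsetP sAB)->].
  apply: leq_trans (leq_card_setU _ _); apply: subset_leq_card.
  by apply/subsetP=> x; rewrite !inE => /andP[-> ->]; case: (x \in A).
have /andP[p1 p2] := part f; have /andP[m1 m2] := part (fun x => ~~ f x).
by apply/andP; split; lia.
Qed.

Lemma imbalance_paired (V : finType) (f : V -> bool) (s : V -> V)
    (A : {set V}) :
  involutive s -> {in A, forall x, s x \in A} ->
  {in A &, forall x y, s x = x -> s y = y -> x = y} ->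
  (forall x, s x != x -> f (s x) = ~~ f x) -> imbalance f A <= 1.
Proof.
move=> sK sA fixA fs; pose B := [set x in A | s x != x].
have sBA : B \subset A by apply/subsetP=> x; rewrite inE => /andP[].
have sB x : x \in B -> s x \in B.
  by rewrite !inE sK eq_sym => /andP[/sA-> ->].
(* [s] injects each colour class of [B] into the other, so the two have equal size. *)
have swap b : #|[set x in B | f x == b]| <= #|[set x in B | f x == ~~ b]|.
  rewrite -(card_imset _ (can_inj sK)); apply: subset_leq_card.
  apply/subsetP=> _ /imsetP[x + ->]; rewrite !inE -!andbA sK.
  move=> /and3P[xA sx /eqP <-].
  by rewrite sA // eq_sym sx fs //=.
have B0 : imbalance f B = 0.
  by have := swap true; have := swap false; rewrite /imbalance /=; lia.
apply: leq_trans (imbalance_sub f sBA) _; rewrite B0 add0n.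
apply/card_le1_eqP => x y; rewrite !inE => /andP[nx xA] /andP[ny yA].
rewrite xA yA !negbK /= in nx ny.
by apply: fixA => //; apply/eqP.
Qed.

Theorem mainTheorem1 (V : finType) (G1 G2 : rel V)
    (hG1 : forest G1) (hG2 : forest G2) :
  exists f : V -> bool, simultaneous_locally_balanced 2 G1 G2 f.
Proof.
have [p1 p1G Gp1] := forest_parent hG1.
have [p2 p2G Gp2] := forest_parent hG2.
(* The classes of [p1] are the sets of children, together with the set of roots as the class of
   [None]. *)
have [s1 [s1K ps1 fix1]] := class_pairing p1.
have [s2 [s2K ps2 fix2]] := class_pairing p2.
have [f [fs1 fs2]] := two_matchings_colouring s1K s2K.
suff bal (G : rel V) p s : (forall x y, p x = Some y -> G x y) ->
    (forall x y, G x y -> p x = Some y \/ p y = Some x) -> involutive s ->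
    (forall x, p (s x) = p x) ->
    (forall x y, s x = x -> s y = y -> p x = p y -> x = y) ->
    (forall x, s x != x -> f (s x) = ~~ f x) -> locally_balanced 2 G f.
  by exists f; split; [apply: (bal _ p1 s1) | apply: (bal _ p2 s2)].
move=> pG Gp sK ps fixs fs v; pose children := [set w | p w == Some v].
have sub : children \subset neighbours G v.
  by apply/subsetP=> w; rewrite !inE => /eqP/pG.
(* The bound 2 splits into 1 for the paired children and 1 for the parent, the only other possible
   neighbour. *)
apply: leq_trans (imbalance_sub f sub) _; apply: (@leq_add _ _ 1 1).
  apply: (imbalance_paired sK) => // [x|x y]; rewrite !inE ?ps //.
  by move=> /eqP px /eqP py sx sy; apply: fixs; rewrite // px.
have parent w : w \in neighbours G v :\: children -> p v = Some w.
  by rewrite !inE => /andP[/eqP nw /Gp[]].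
by apply/card_le1_eqP => x y /parent px /parent; rewrite px => -[].
Qed.
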